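(* Let $(S,\oplus,\otimes,\bar 0,\bar 1)$ be a semiring, with $\oplus$ and $\otimes$ differentiable with respect to both arguments, such that the monoid $(S,\oplus,\bar 0)$ is isomorphic to $(\mathbb{R},+,0)$, and let $\mu:S\to\mathbb{R}$ be the associated (iso)morphism and $\mu^{-1}$ its inverse. For all $\mathbf{x}=(x_1,\dots,x_K)\in S^K$ and $\mathbf{y}=(y_1,\dots,y_K)\in S^K$, if $$z=(x_1\otimes y_1)\oplus\cdots\oplus(x_K\otimes y_K),$$ then $$\frac{\partial z}{\partial x_i}=\frac{\partial z}{\partial \mu(z)}\,\frac{\partial \mu(x_i\otimes y_i)}{\partial (x_i\otimes y_i)}\,\frac{\partial (x_i\otimes y_i)}{\partial x_i}.$$
   Context: A monoid $(M,\odot,\epsilon)$ is a non-empty set $M$ with an associative binary operation $\odot$ and a two-sided neutral element $\epsilon$. A monoid morphism $\mu:(M,\odot,\epsilon)\to(M',\bullet,\epsilon')$ is a map with $\mu(x\odot y)=\mu(x)\bullet\mu(y)$ for all $x,y\in M$ and $\mu(\epsilon)=\epsilon'$; it is an isomorphism if it is bijective, and two monoids are isomorphic if they are linked by an isomorphism. A semiring $(S,\oplus,\otimes,\bar 0,\bar 1)$ is a set $S$ such that $(S,\oplus,\bar 0)$ is a commutative monoid, $(S,\otimes,\bar 1)$ is a monoid, $\otimes$ distributes over $\oplus$ on both sides, and $x\otimes\bar 0=\bar 0\otimes x=\bar 0$ for all $x\in S$. Here $K$ is a positive integer, $i$ ranges over $\{1,\dots,K\}$, and $z$ is regarded as a function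 of $\mathbf{x}$ and $\mathbf{y}$. Notation for derivatives, with $z$ written as $z=\mu^{-1}[\mu(z)]=\mu^{-1}[\mu(x_1\otimes y_1)+\cdots+\mu(x_K\otimes y_K)]$: $\frac{\partial z}{\partial\mu(z)}$ denotes the derivative of $\mu^{-1}$ at $\mu(z)$; $\frac{\partial\mu(x_i\otimes y_i)}{\partial(x_i\otimes y_i)}$ denotes the derivative of $\mu$ at $x_i\otimes y_i$; $\frac{\partial(x_i\otimes y_i)}{\partial x_i}$ denotes the partial derivative of $(a,b)\mapsto a\otimes b$ with respect to its first argument at $(x_i,y_i)$.
   Formalization: S is taken to be an open subset of the reals and the isomorphism μ is assumed continuous; a discontinuous additive bijection μ of (R,+) has no derivative anywhere, so the formula would be undefined. Existence of the derivatives is proved. *)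

(* Defs.v *)
From HB Require Import structures.
From mathcomp Require Import all_boot all_order all_algebra.
From mathcomp Require Import all_classical all_reals all_analysis.
Import Order.TTheory GRing.Theory Num.Theory.
Import numFieldNormedType.Exports.

Set Implicit Arguments.
Unset Strict Implicit.
Unset Printing Implicit Defensive.

Local Open Scope classical_set_scope.
Local Open Scope ring_scope.

(* MathComp-Analysis, over an arbitrary R : realType.

   The semiring lives on a subset S of R, with operations that have nothing to
   do with the ring structure of R, so the algebraic axioms are relativized to
   S. Operations are total functions on R; their values outside S are never
   constrained. *)

Definition monoid_on (T : Type) (M : set T) (op : T -> T -> T) (e : T) : Prop :=
  [/\ M e,
      forall x y, M x -> M y -> M (op x y),
      forall x y z, M x -> M y -> M z -> op x (op y z) = op (op x y) z
    & forall x, M x -> op e x = x /\ op x e = x].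

Definition monoid_morphism_on (T T' : Type)
    (M : set T) (op : T -> T -> T) (e : T)
    (M' : set T') (op' : T' -> T' -> T') (e' : T') (mu : T -> T') : Prop :=
  [/\ forall x, M x -> M' (mu x),
      forall x y, M x -> M y -> mu (op x y) = op' (mu x) (mu y)
    & mu e = e'].

Definition monoid_isomorphism_on (T T' : Type)
    (M : set T) (op : T -> T -> T) (e : T)
    (M' : set T') (op' : T' -> T' -> T') (e' : T') (mu : T -> T') : Prop :=
  monoid_morphism_on M op e M' op' e' mu /\ set_bij M M' mu.

Definition semiring_on (T : Type) (S : set T)
    (add mul : T -> T -> T) (zero one : T) : Prop :=
  [/\ monoid_on S add zero,
      forall x y, S x -> S y -> add x y = add y x,
      monoid_on S mul one,
      forall x y z, S x -> S y -> S z ->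
        mul x (add y z) = add (mul x y) (mul x z) /\
        mul (add x y) z = add (mul x z) (mul y z)
    & forall x, S x -> mul x zero = zero /\ mul zero x = zero].

(* Only the two one-variable maps are required to be differentiable, not the
   map of the pair. For open S this does not depend on the values of op
   outside S. *)
Definition differentiable_in_both_arguments (R : realType) (S : set R)
    (op : R -> R -> R) : Prop :=
  forall a b, S a -> S b ->
    derivable (fun t => op t b) a 1 /\ derivable (fun t => op a t) b 1.

Definition semiring_dot (R : realType) (add mul : R -> R -> R) (zero : R)
    (K : nat) (x y : 'rV[R]_K) : R :=
  \big[add/zero]_(j < K) mul (x ord0 j) (y ord0 j).

(* Partial derivative with respect to the i-th coordinate: the derivative in
   the direction of the i-th vector of the canonical basis. *)
Definition has_partial (R : realType) (K : nat) (i : 'I_K)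
    (f : 'rV[R]_K -> R) (x : 'rV[R]_K) : Prop :=
  derivable f x (delta_mx ord0 i).

Definition partial (R : realType) (K : nat) (i : 'I_K)
    (f : 'rV[R]_K -> R) (x : 'rV[R]_K) : R :=
  derive f x (delta_mx ord0 i).

(* Main.v *)
(* Everything but the chain rule lies in showing that mu is differentiable with
   nonzero derivative, although mu is only assumed continuous. Let g be the
   inverse of mu, so that g (s + h) = add (g s) (g h). Since add is
   differentiable in its second argument at zero = g 0, the quotient
     q h s = (g (s + h) - g s) / (g h - g 0)
   has a limit phi s as h tends to 0, for every s. By Baire, q h s is bounded
   uniformly in small h on some interval [a, b], so by dominated convergence
   the integral of q h over [a, b] tends to that of phi. On the other hand
   this integral is the integral of g (s + h) - g s, which is equivalent to
   h (g b - g a), divided by g h - g 0. Hence h / (g h - g 0) converges,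
   which says that mu is differentiable at zero. Translating by add transfers
   the derivative to all points, and if it vanished at one point it would
   vanish at all of them, making mu constant near that point. *)

Require Import Defs.
From HB Require Import structures.
From mathcomp Require Import all_boot all_order all_algebra.
From mathcomp Require Import lra.
From mathcomp Require Import all_classical all_reals all_analysis.
Import Order.TTheory GRing.Theory Num.Theory.
Import numFieldNormedType.Exports.
Local Open Scope classical_set_scope.
Local Open Scope ring_scope.

Set Implicit Arguments.
Unset Strict Implicit.

(** * Baire category and limits under the integral sign *)

(** Baire category turns bounds depending on [s] into one bound on an interval: countably many
    closed sets cover the line, so one of them has interior. *)
Lemma locally_uniform_bound (R : realType) (q : R -> R -> R) :
  (forall h, continuous (q h)) ->
  (forall s, exists M, \forall h \near 0^', `|q h s| <= M) ->
  exists M a b, a < b /\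
    \forall h \near 0^', forall s, a <= s <= b -> `|q h s| <= M.
Proof.
move=> q_cont q_bnd.
(* The same [n] sets both the bound and the radius, so the family is countable; a large enough [n]
   still captures any given [s]. *)
pose F (n : nat) := [set s : R | forall h, h != 0 -> `|h| < n.+1%:R^-1 ->
  `|q h s| <= n%:R].
have F_closed n : closed (F n).
  have -> : F n = \bigcap_(h in [set h : R | h != 0 /\ `|h| < n.+1%:R^-1])
      [set s | `|q h s| <= n%:R].
    apply/seteqP; split=> s /= Fs h; first by case; exact: Fs.
    by move=> h0 hn; apply: Fs.
  apply: closed_bigI => h _.
  have := (@closed_comp _ _ (fun s => `|q h s|) [set y | y <= n%:R]).
  apply; last exact: closed_le.
  by move=> s _; apply: continuous_comp; [exact: q_cont|exact: norm_continuous].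
have [n /denseNE[U [[s [U_open Us]] UF]]] : exists n, ~ dense (~` F n).
  apply/existsNP => F_dense.
  have F_Baire n : open (~` F n) /\ dense (~` F n).
    by split; [exact: closed_openC|exact: F_dense].
  have [s [_ Fs]] := Baire F_Baire (ex_intro _ 0 I) openT.
  have [M [e /= e_gt0 qM]] := q_bnd s.
  near \oo => n; apply: (Fs n I) => h h0 hn.
  apply: (@le_trans _ _ M).
    apply: qM => //=; rewrite sub0r normrN (lt_trans hn)//.
    by near: n; exact: near_infty_natSinv_lt (PosNum e_gt0).
  by near: n; exact: nbhs_infty_ger.
have [e /= e_gt0 Ue] := open_nbhs_nbhs (conj U_open Us).
exists n%:R, (s - e / 2), (s + e / 2); split.
  by rewrite ltrD2l gtrN ?divr_gt0.
exists n.+1%:R^-1 => /=; first by rewrite invr_gt0.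
move=> h /=; rewrite sub0r normrN => hn h0 t ste.
have Ut : U t.
  apply: Ue; rewrite /= distrC ltr_norml.
  by move: ste => /andP[? ?]; apply/andP; split; lra.
suff : F n t by apply.
by apply: contrapT => Ft; have : (U `&` ~` F n) t by []; rewrite UF.
Unshelve. all: by end_near. Qed.

Lemma dominated_cvg_dnbhs (R : realType) (q : R -> R -> R) (phi : R -> R)
    (M a b : R) :
  (forall h, continuous (q h)) ->
  (forall s, q h s @[h --> 0^'] --> phi s) ->
  (\forall h \near 0^', forall s, a <= s <= b -> `|q h s| <= M) ->
  (\int[lebesgue_measure]_(s in `[a, b]) q h s) @[h --> 0^'] -->
    \int[lebesgue_measure]_(s in `[a, b]) phi s.
Proof.
move=> q_cont q_phi [e /= e_gt0 qM]; apply/cvgr_dnbhsP => u [u0 u_cvg].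
(* Domination is needed for every term, so the sequence is started at an index [N] from which [u]
   stays within [e] of 0. *)
have [N _ Ne] := (cvgrPdist_lt _ _).1 u_cvg _ e_gt0.
rewrite -(cvg_shiftn N) /=.
have q_int n :
    lebesgue_measure.-integrable `[a, b] (EFin \o q (u (n + N)%N)).
  apply: continuous_compact_integrable; first exact: segment_compact.
  exact/continuous_subspaceT.
have mq n := measurable_int _ (q_int n).
have q_lim s : `[a, b]%classic s ->
    (EFin \o q (u (n + N)%N)) s @[n --> \oo] --> (EFin \o phi) s.
  move=> _; apply: cvg_EFin; first by near=> n.
  have /cvgr_dnbhsP/(_ u (conj u0 u_cvg)) := q_phi s.
  by rewrite -(cvg_shiftn N).
have M_int : lebesgue_measure.-integrable `[a, b] (EFin \o cst M : R -> \bar R).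
  apply: continuous_compact_integrable; first exact: segment_compact.
  by move=> s; exact: cvg_cst.
have q_dom n s : `[a, b]%classic s ->
    (`|(EFin \o q (u (n + N)%N)) s| <= (EFin \o cst M) s)%E.
  rewrite /= in_itv /= lee_fin => /qM; apply => //.
  by apply: (Ne (n + N)%N) => /=; rewrite leq_addl.
have mab : measurable (`[a, b]%classic : set (measurableTypeR R)) by [].
apply: fine_cvg; rewrite fineK; last first.
  apply: integrable_fin_num => //.
  exact: (lebesgue_integral_dominated_convergence.dominated_integrable
            mab _ _ _ mq q_lim M_int q_dom).
have M_fin s : `[a, b]%classic s -> (EFin \o cst M) s \is a fin_num by [].
exact: (dominated_cvg mab mq q_lim M_fin M_int q_dom).
Unshelve. all: by end_near. Qed.

(** * Primitives and difference quotients *)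

Lemma continuous_has_primitive (R : realType) (g : R -> R) (c d : R) :
  continuous g ->
  exists G : R -> R, forall x, c < x < d -> is_derive x 1 G (g x).
Proof.
move=> g_cont.
exists (fun x => \int[lebesgue_measure]_(t in `[c, x]) g t) => x /andP[cx xd].
have g_int : lebesgue_measure.-integrable `[c, d] (EFin \o g).
  apply: continuous_compact_integrable; first exact: segment_compact.
  exact/continuous_subspaceT.
have [] := continuous_FTC1_closed xd g_int cx (g_cont x).
by move=> dG G'; apply: DeriveDef => //; rewrite -derive1E.
Qed.

Lemma is_derive1P (R : realType) (f : R -> R) (x l : R) :
  is_derive x 1 f l <-> h^-1 * (f (h + x) - f x) @[h --> 0^'] --> l.
Proof.
have quotE : (fun h => h^-1 *: ((f \o shift x) (h *: 1) - f x)) =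
    (fun h => h^-1 * (f (h + x) - f x)).
  by apply/funext => h; rewrite /= [h *: 1]mulr1.
split=> [[+ <-]|fl]; first by rewrite /derivable /derive quotE.
by apply: DeriveDef; rewrite /derivable /derive quotE;
  [exact: cvgP fl|exact: cvg_lim fl].
Qed.

Lemma continuous_translateB (R : realType) (g : R -> R) (h : R) :
  continuous g -> continuous (fun x => g (x + h) - g x).
Proof.
move=> g_cont x; apply: continuousB; last exact: g_cont.
apply: (@continuous_comp _ _ _ (shift h) g); last exact: g_cont.
by apply: continuousD => //; exact: cvg_cst.
Qed.

(** For a primitive [G] of [g], the integral is the increment of [G] at [b] minus its increment at
    [a]. *)
Lemma cvg_mean_translate (R : realType) (g : R -> R) (a b : R) :
  continuous g -> a < b ->
  h^-1 * (\int[lebesgue_measure]_(s in `[a, b]) (g (s + h) - g s))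
    @[h --> 0^'] --> g b - g a.
Proof.
move=> g_cont ab.
(* The margin 1 keeps [x + h] where [G] has derivative [g], for [x] in [[a, b]] and [|h| < 1]. *)
have [G dG] := @continuous_has_primitive _ g (a - 1) (b + 1) g_cont.
have quot x : a <= x <= b -> h^-1 * (G (h + x) - G x) @[h --> 0^'] --> g x.
  move=> /andP[ax xb].
  by apply/is_derive1P/dG/andP; split; lra.
apply: cvg_trans (cvgB (quot b _) (quot a _)); rewrite ?lexx ?ltW//.
apply: near_eq_cvg; near=> h => /=.
have h1 : `|h| < 1 by near: h; apply: dnbhs0_lt.
have /andP[h1l h1r] : -1 < h < 1 by rewrite -ltr_norml.
pose F x := G (x + h) - G x.
have dF x : a <= x <= b -> is_derive x 1 F (g (x + h) - g x).
  move=> /andP[ax xb].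
  have ? : is_derive x 1 G (g x) by apply: dG; apply/andP; split; lra.
  have ? : is_derive (x + h) 1 G (g (x + h)).
    by apply: dG; apply/andP; split; lra.
  have ? : is_derive x 1 (G \o shift h) (g (x + h)).
    apply/is_derive1P => /=; under eq_fun do rewrite -addrA.
    exact/is_derive1P.
  exact: is_deriveB.
have F_cont x : a <= x <= b -> {for x, continuous F}.
  move=> /dF dFx; apply/differentiable_continuous/derivable1_diffP.
  exact: ex_derive.
have gB_cont := @continuous_translateB R g h g_cont.
rewrite /Rintegral (@continuous_FTC2 _ (fun x : R => g (x + h) - g x) F)//=.
- by rewrite !fctE /F [b + h]addrC [a + h]addrC -mulrBr.
- exact: continuous_subspaceT.
- split.
  + move=> x; rewrite in_itv /= => /andP[ax xb].
    by have [|] := dF x; rewrite ?ltW.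
  + by apply: cvg_at_right_filter; apply: F_cont; rewrite lexx ltW.
  + by apply: cvg_at_left_filter; apply: F_cont; rewrite lexx ltW.
- move=> x; rewrite in_itv /= => /andP[ax xb].
  by have [|_ <-] := dF x; rewrite ?ltW// derive1E.
Unshelve. all: by end_near. Qed.

Lemma cvg_translate_ratio (R : realType) (g phi : R -> R) :
  continuous g -> injective g ->
  (forall s : R,
    (g (s + h) - g s) / (g h - g 0) @[h --> (0 : R)^'] --> phi s) ->
  exists l : R, h / (g h - g 0) @[h --> (0 : R)^'] --> l.
Proof.
move=> g_cont g_inj g_phi.
pose q h s := (g (s + h) - g s) / (g h - g 0).
have gB_cont h := @continuous_translateB R g h g_cont.
have q_cont h : continuous (q h).
  by move=> s; apply: cvgM; [exact: gB_cont|exact: cvg_cst].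
have [|M [a [b [ab qM]]]] := locally_uniform_bound q_cont.
  move=> s; exists (`|phi s| + 1).
  have /cvgrPdist_le/(_ _ ltr01) := g_phi s.
  apply: filterS => h; rewrite -/(q h s) => qphi.
  rewrite -(subrK (phi s) (q h s)) addrC (le_trans (ler_normD _ _))//.
  by rewrite lerD2l distrC.
have int_cvg := dominated_cvg_dnbhs q_cont g_phi qM.
have mean_cvg := cvg_mean_translate g_cont ab.
have gab0 : g b - g a != 0.
  by rewrite subr_eq0; apply/eqP => /g_inj ba; rewrite ba ltxx in ab.
(* The integral of [g (s + h) - g s], nonzero for small [h], cancels between the two factors and
   leaves [h / (g h - g 0)]. *)
eexists; apply: cvg_trans (cvgM int_cvg (cvgV gab0 mean_cvg)).
apply: near_eq_cvg; near=> h => /=.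
have h0 : h != 0 by near: h; exact: nbhs_dnbhs_neq.
have : h^-1 * (\int[lebesgue_measure]_(s in `[a, b]) (g (s + h) - g s)) != 0.
  by near: h; exact: (cvgr_neq0 _ mean_cvg gab0).
rewrite mulf_eq0 negb_or => /andP[_ int0].
set I := \int[_]_(s in _) _ in int0 *.
have -> : \int[lebesgue_measure]_(s in `[a, b]) q h s = I / (g h - g 0).
  rewrite /q RintegralZr//; apply: continuous_compact_integrable.
    exact: segment_compact.
  exact: continuous_subspaceT.
by rewrite invfM invrK [h / I]mulrC mulrACA divff// mul1r mulrC.
Unshelve. all: by end_near. Qed.

(** Justifies substituting an increment of [f] for the variable of a punctured limit. *)
Lemma cvg_subr_dnbhs (R : realType) (f : R -> R) (x : R) :
  continuous_at x f -> (\forall h \near 0^', f (h + x) != f x) ->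
  f (h + x) - f x @[h --> 0^'] --> 0^'.
Proof.
move=> fx f_neq A [e /= e_gt0 eA].
have /cvgrPdist_lt/(_ e e_gt0) fxe : f (h + x) @[h --> 0^'] --> f x.
  exact/continuous_withinNshiftx.
suff : \forall h \near 0^', A (f (h + x) - f x) by [].
apply: filterS2 fxe f_neq => h fxh fhx; apply: eA => /=.
  by rewrite sub0r opprB.
by rewrite subr_eq0.
Qed.

(** The increments of [g] serve as the step in the quotient of [f], so [g] need only be
    continuous. *)
Lemma is_derive_cvg_ratio (R : realType) (f g : R -> R) (x l : R) :
  is_derive (g x) 1 f l -> continuous_at x g ->
  (\forall h \near 0^', g (h + x) != g x) ->
  (f (g (h + x)) - f (g x)) / (g (h + x) - g x) @[h --> 0^'] --> l.
Proof.
move=> /is_derive1P fl gx g_neq.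
have -> : (fun h => (f (g (h + x)) - f (g x)) / (g (h + x) - g x)) =
    (fun k => k^-1 * (f (k + g x) - f (g x))) \o (fun h => g (h + x) - g x).
  by apply/funext => h /=; rewrite subrK mulrC.
exact: cvg_comp (cvg_subr_dnbhs gx g_neq) fl.
Qed.

(** * The inverse of the isomorphism and the differentiability of [mu] *)

Lemma monoid_iso_inverse (T : Type) (V : zmodType) (S : set T)
    (add : T -> T -> T) (zero : T) (mu : T -> V) (g : V -> T) :
  monoid_on S add zero ->
  monoid_isomorphism_on S add zero [set: V] +%R 0 mu ->
  (forall a, S a -> g (mu a) = a) ->
  [/\ forall t, S (g t), cancel g mu, g 0 = zero
    & forall s t, g (s + t) = add (g s) (g t)].
Proof.
move=> [Szero Sadd _ _] [[_ muD mu0] [_ _ mu_surj]] muK.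
have gP t : S (g t) /\ mu (g t) = t.
  by have [a Sa <-] := mu_surj t I; rewrite muK.
split=> [t|t||s t]; [by case: (gP t)|by case: (gP t)|by rewrite -mu0 muK|].
have [[Ss mus] [St mut]] := (gP s, gP t).
by rewrite -[in LHS]mus -[in LHS]mut -muD// muK//; exact: Sadd.
Qed.

(** Near [g t] the map [f] is continuous and injective, and on the line this makes its local inverse
    continuous. *)
Lemma continuous_open_inverse (R : realType) (S : set R) (f g : R -> R) :
  open S -> (forall a, S a -> g (f a) = a) -> (forall t, S (g t)) ->
  cancel g f -> (forall a, S a -> continuous_at a f) -> continuous g.
Proof.
move=> S_open fK gS gK f_cont t; rewrite -(gK t).
have Sgt : \forall x \near g t, S x by exact: open_nbhs_nbhs.
have fK_near : {near g t, cancel f g} by exact: filterS Sgt.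
have f_near : {near g t, continuous f} by exact: filterS Sgt.
exact: nbhs_singleton (near_can_continuous fK_near f_near).
Qed.

Section MonoidIso.
Context (R : realType) (S : set R) (add : R -> R -> R) (zero : R).
Context (mu : R -> R).
Hypotheses (S_open : open S) (S_monoid : monoid_on S add zero)
  (add_diff : differentiable_in_both_arguments S add)
  (mu_iso : monoid_isomorphism_on S add zero [set: R] +%R 0 mu)
  (mu_cont : forall a, S a -> continuous_at a mu).

(** Near [b], [mu] is [mu \o add s] minus a constant, where [add s b = a]. The product form [l * c]
    lets a zero derivative spread to all of [S]. *)
Lemma monoid_iso_is_derive_transfer a b l : S a -> S b ->
  is_derive a 1 mu l -> exists c, is_derive b 1 mu (l * c).
Proof.
have [_ [_ _ mu_surj]] := mu_iso.
move=> Sa Sb mu_a; have [s Ss mus] := mu_surj (mu a - mu b) I.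
have [[_ muD _] [_ mu_inj _]] := mu_iso.
have [_ Sadd _ _] := S_monoid.
have sbE : add s b = a.
  by apply: mu_inj; rewrite ?inE//; [exact: Sadd|rewrite muD// mus subrK].
have add_b := (add_diff Ss Sb).2.
exists ('D_1 (add s) b).
have mu_sb : is_derive b 1 (mu \o add s) (l * 'D_1 (add s) b).
  by apply: is_derive1_comp; rewrite ?sbE//; exact: DeriveDef.
have mu_sbB : is_derive b 1 (fun x => mu (add s x) - mu s) (l * 'D_1 (add s) b).
  by rewrite -[X in is_derive _ _ _ X]subr0; exact: is_deriveB.
apply: near_eq_is_derive mu_sbB.
apply: filterS (open_nbhs_nbhs (conj S_open Sb)) => x Sx.
by rewrite muD// addrC addKr.
Qed.

Lemma monoid_iso_derivable_zero : derivable mu zero 1.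
Proof.
(* The default [zero] is never taken, because [mu] is onto. *)
pose g t := xget zero [set a | S a /\ mu a = t].
have [[_ muD mu0] [_ mu_inj _]] := mu_iso.
have muK a : S a -> g (mu a) = a.
  move=> Sa; rewrite /g; case: xgetP => [b _ [Sb mub]|/(_ a)].
    by apply: mu_inj; rewrite ?inE.
  by case.
have [gS gK g0 gD] := monoid_iso_inverse S_monoid mu_iso muK.
have g_inj : injective g := can_inj gK.
have g_cont := continuous_open_inverse S_open muK gS gK mu_cont.
have [Szero _ _ _] := S_monoid.
have [|l gl] := cvg_translate_ratio
    (phi := fun s => 'D_1 (add (g s)) zero) g_cont g_inj.
  move=> s.
  have add_gs : is_derive (g 0) 1 (add (g s)) ('D_1 (add (g s)) zero).
    by rewrite g0; apply: DeriveDef => //; exact: (add_diff (gS s) Szero).2.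
  have g_neq : \forall h \near 0^', g (h + 0) != g 0.
    near=> h; rewrite addr0 (inj_eq g_inj).
    by near: h; exact: nbhs_dnbhs_neq.
  have := is_derive_cvg_ratio add_gs (g_cont 0) g_neq.
  by under eq_fun do rewrite -!gD !addr0.
suff : is_derive zero 1 mu l by move/@ex_derive.
have S_near : \forall k \near 0^', S (k + zero).
  apply: nbhs_dnbhs; apply: (cvgD cvg_id (cvg_cst zero)).
  by rewrite add0r; exact: open_nbhs_nbhs.
have mu_neq : \forall k \near 0^', mu (k + zero) != mu zero.
  near=> k; apply/eqP => /mu_inj; rewrite !inE.
  have Sk : S (k + zero) by near: k.
  move=> /(_ Sk Szero)/(canRL (addrK _)); rewrite subrr; apply/eqP.
  by near: k; exact: nbhs_dnbhs_neq.
apply/is_derive1P.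
(* Substituting [h = mu (k + zero)] gives [g h - g 0 = k], so the ratio becomes the difference
   quotient of [mu] at [zero]. *)
apply: cvg_trans (cvg_comp _ _ (cvg_subr_dnbhs (mu_cont Szero) mu_neq) gl).
apply: near_eq_cvg; near=> k => /=.
have Sk : S (k + zero) by near: k.
by rewrite mu0 subr0 muK// g0 addrK mulrC.
Unshelve. all: by end_near. Qed.

Lemma monoid_iso_is_derive a : S a -> exists2 l, l != 0 & is_derive a 1 mu l.
Proof.
move=> Sa; have [Szero _ _ _] := S_monoid.
have mu_zero : is_derive zero 1 mu ('D_1 mu zero).
  by apply: DeriveDef; first exact: monoid_iso_derivable_zero.
have [c mu_a] := monoid_iso_is_derive_transfer Szero Sa mu_zero.
have [l0|] := eqVneq ('D_1 mu zero * c) 0; last by exists ('D_1 mu zero * c).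
have mu'0 b : S b -> is_derive b 1 mu 0.
  move=> Sb; have [d] := monoid_iso_is_derive_transfer Sa Sb mu_a.
  by rewrite l0 mul0r.
(* [S] is not known to be an interval, so the mean value theorem is applied on a short segment
   starting at [a]. *)
have [e /= e_gt0 eS] := open_nbhs_nbhs (conj S_open Sa).
have itvS x : x \in `[a, a + e / 2] -> S x.
  rewrite in_itv /= => /andP[ax xae]; apply: eS => /=.
  by rewrite ler0_norm ?subr_le0// opprB; lra.
have ae : a < a + e / 2 by rewrite ltrDl divr_gt0.
have [||x _] := @MVT_segment _ mu (fun=> 0) a (a + e / 2) (ltW ae).
- by move=> x xae; apply: mu'0; apply: itvS; exact: subset_itv_oo_cc.
- by apply: derivable_within_continuous => x /itvS/mu'0 [+ _].
have [_ [_ mu_inj _]] := mu_iso.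
rewrite mul0r => /eqP; rewrite subr_eq0 => /eqP/mu_inj.
rewrite !inE => aeE; move: (ae); rewrite aeE ?ltxx//.
  by apply: itvS; rewrite in_itv /= lexx andbT ltW.
Qed.

End MonoidIso.

(** * The chain rule along one coordinate *)

(** Agreement is asked only near the point because the closed form of [semiring_dot] is valid only
    for coordinates in [S]. *)
Lemma is_partial_of_coordinate (R : realType) (K : nat) (i : 'I_K)
    (f : 'rV[R]_K -> R) (x : 'rV[R]_K) (phi : R -> R) (l : R) :
  (\forall a \near x ord0 i,
    f ((a - x ord0 i) *: delta_mx ord0 i + x) = phi a) ->
  is_derive (x ord0 i) 1 phi l -> is_derive x (delta_mx ord0 i) f l.
Proof.
move=> f_phi /is_derive1P phi_l; set v := delta_mx _ _ in f_phi *.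
have fx : f x = phi (x ord0 i).
  by have := nbhs_singleton f_phi; rewrite /= subrr scale0r add0r.
suff quot : h^-1 *: ((f \o shift x) (h *: v) - f x) @[h --> 0^'] --> l.
  by apply: DeriveDef; [exact: cvgP quot|exact: cvg_lim quot].
apply: cvg_trans phi_l; apply: near_eq_cvg.
have h_cvg : (h + x ord0 i) @[h --> 0^'] --> x ord0 i.
  rewrite -[X in _ --> X]add0r; apply: cvgD; last exact: cvg_cst.
  exact: nbhs_dnbhs.
have near_phi : \forall h \near 0^',
    f ((h + x ord0 i - x ord0 i) *: v + x) = phi (h + x ord0 i).
  exact: h_cvg f_phi.
apply: filterS near_phi => h /=.
by rewrite addrK fx => ->.
Qed.

(** Membership in [S] is carried through the induction, since [mu] is additive only there. *)
Lemma semiring_dotE (R : realType) (S : set R) (add mul : R -> R -> R)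
    (zero one : R) (mu : R -> R) (K : nat) (x y : 'rV[R]_K) :
  semiring_on S add mul zero one ->
  monoid_isomorphism_on S add zero [set: R] +%R 0 mu ->
  (forall j, S (x ord0 j)) -> (forall j, S (y ord0 j)) ->
  S (semiring_dot add mul zero x y) /\
  mu (semiring_dot add mul zero x y) = \sum_j mu (mul (x ord0 j) (y ord0 j)).
Proof.
move=> [[Szero Sadd _ _] _ [_ Smul _ _] _ _] [[_ muD mu0] _] xS yS.
rewrite /semiring_dot.
apply: (@big_ind2 _ _ (fun a t => S a /\ mu a = t)) => // [a s b t|j _].
  by move=> [Sa <-] [Sb <-]; split; [exact: Sadd|exact: muD].
by split=> //; exact: Smul.
Qed.

(* An isomorphism of abstract monoids need not be continuous (for S = R and
   add = +, take a discontinuous additive bijection), and then it has no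
   derivative anywhere; mu_cont excludes exactly these. The existence of all
   the derivatives in the formula is part of the conclusion. *)
Theorem proposition5p1 (R : realType) (S : set R)
    (add mul : R -> R -> R) (zero one : R) (mu muinv : R -> R)
    (S_open : open S)
    (S_semiring : semiring_on S add mul zero one)
    (add_diff : differentiable_in_both_arguments S add)
    (mul_diff : differentiable_in_both_arguments S mul)
    (mu_iso : monoid_isomorphism_on S add zero [set: R] +%R 0 mu)
    (muinvK : forall a, S a -> muinv (mu a) = a)
    (mu_cont : forall a, S a -> continuous_at a mu)
    (K : nat) (K_gt0 : (0 < K)%N) (x y : 'rV[R]_K)
    (xS : forall j, S (x ord0 j)) (yS : forall j, S (y ord0 j))
    (z : R) (zE : z = semiring_dot add mul zero x y) (i : 'I_K) :
  [/\ derivable muinv (mu z) 1,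
      derivable mu (mul (x ord0 i) (y ord0 i)) 1,
      has_partial i (fun x' => semiring_dot add mul zero x' y) x
    & partial i (fun x' => semiring_dot add mul zero x' y) x =
        derive1 muinv (mu z) *
        derive1 mu (mul (x ord0 i) (y ord0 i)) *
        derive1 (fun a => mul a (y ord0 i)) (x ord0 i)].
Proof.
have [S_monoid _ [_ Smul _ _] _ _] := S_semiring.
have mu_der := monoid_iso_is_derive S_open S_monoid add_diff mu_iso mu_cont.
have [Sz muzE] := semiring_dotE S_semiring mu_iso xS yS; rewrite -zE in Sz muzE.
(* The inverse function rule applies because the derivative of [mu] at [z] is nonzero. *)
have muinv_z : derivable muinv (mu z) 1.
  have [l l0 mu_z] := mu_der _ Sz.
  have Sz_near := open_nbhs_nbhs (conj S_open Sz).
  have muinvK_near : {near z, cancel mu muinv} by exact: filterS Sz_near.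
  have mu_near : {near z, continuous mu} by exact: filterS Sz_near.
  by have [] := is_derive_inverse muinvK_near mu_near mu_z l0.
have mu_xy : derivable mu (mul (x ord0 i) (y ord0 i)) 1.
  by have [l _ []] := mu_der _ (Smul _ _ (xS i) (yS i)).
have mul_x := (mul_diff _ _ (xS i) (yS i)).1.
(* [c] gathers the terms independent of the [i]-th coordinate, and [phi] is [z] as a function of
   that coordinate alone. *)
pose c := \sum_(j | j != i) mu (mul (x ord0 j) (y ord0 j)).
pose phi a := muinv (mu (mul a (y ord0 i)) + c).
have muzE' : mu (mul (x ord0 i) (y ord0 i)) + c = mu z.
  by rewrite muzE (bigD1 i).
have phi_x : is_derive (x ord0 i) 1 phi (derive1 muinv (mu z) *
    (derive1 mu (mul (x ord0 i) (y ord0 i)) *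
     derive1 (fun a => mul a (y ord0 i)) (x ord0 i))).
  rewrite !derive1E.
  apply: (@is_derive1_comp _ muinv (fun a => mu (mul a (y ord0 i)) + c)).
    by rewrite muzE'; exact: DeriveDef.
  rewrite -[X in is_derive _ _ _ X]addr0; apply: is_deriveD.
  apply: (@is_derive1_comp _ mu (fun a => mul a (y ord0 i))).
    exact: DeriveDef.
  exact: DeriveDef.
have partial_x : is_derive x (delta_mx ord0 i)
    (fun x' => semiring_dot add mul zero x' y) (derive1 muinv (mu z) *
    (derive1 mu (mul (x ord0 i) (y ord0 i)) *
     derive1 (fun a => mul a (y ord0 i)) (x ord0 i))).
  apply: is_partial_of_coordinate phi_x.
  apply: filterS (open_nbhs_nbhs (conj S_open (xS i))) => a Sa.
  set x' := _ + x.
  have x'i : x' ord0 i = a by rewrite !mxE !eqxx mulr1 subrK.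
  have x'j j : j != i -> x' ord0 j = x ord0 j.
    by move=> ji; rewrite !mxE (negbTE ji) andbF mulr0 add0r.
  have x'S j : S (x' ord0 j).
    by have [->|/x'j ->] := eqVneq j i; rewrite ?x'i.
  have [Sz' muz'E] := semiring_dotE S_semiring mu_iso x'S yS.
  rewrite -[LHS]muinvK// muz'E (bigD1 i)//= x'i /phi /c.
  by congr (muinv (_ + _)); apply: eq_bigr => j /x'j ->.
by split=> //; [exact: ex_derive|rewrite -mulrA /partial derive_val].
Qed.
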